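(* Let $I\subseteq S=\Bbbk[x_1,\ldots,x_n]$ be a monomial ideal over a field $\Bbbk$. For every $\mathbf a\in\mathbb Z^n$, the exponent simplicial complex $\mathrm{E}\Delta_{\mathbf a}$ of $I$ is a cone with apex $\mathrm{supp}(\mathbf a_-)$, and the Čech simplicial complex $\check{C}\Delta_{\mathbf a}$ of $I$ is the link of the apex: $$\check{C}\Delta_{\mathbf a}=\mathrm{link}(\mathrm{supp}(\mathbf a_-),\mathrm{E}\Delta_{\mathbf a}).$$ More generally, for $\alpha\in\mathbb C^n$, define $\alpha'\in\mathbb Z^n$ by setting to $-1$ all coordinates of $\alpha$ that lie outside of $\mathbb N$ (leaving the others unchanged). Then $\mathrm{E}\Delta_\alpha$ is a cone with apex $\alpha'_-$ and $$\check{C}\Delta_{\alpha'}=\mathrm{link}(\alpha'_-,\mathrm{E}\Delta_\alpha).$$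
   Context: $\mathbb N$ is the set of nonnegative integers. A subset $F\subseteq\{1,\ldots,n\}$ is identified with its characteristic $0/1$ vector in $\mathbb N^n$; in particular $\alpha'_-$, which has entries in $\{0,1\}$, is regarded as a subset of $\{1,\ldots,n\}$. For a vector $\mathbf a\in\mathbb Z^n$, $\mathrm{supp}(\mathbf a)=\{i\mid a_i\ne 0\}$, and $\mathbf a=\mathbf a_+-\mathbf a_-$ is the decomposition into positive and negative parts, i.e. $\mathbf a_+,\mathbf a_-\in\mathbb N^n$ have disjoint supports. $\mathbb C^F\subseteq\mathbb C^n$ is the coordinate subspace of vectors with support contained in $F$. $\Lambda_I\subseteq\mathbb N^n$ is the set of exponent vectors of monomials not in $I$. The distracting arrangement $V_I\subseteq\mathbb C^n$ is the Zariski closure of $\Lambda_I$ in $\mathbb C^n$; it is a finite union of translates of coordinate subspaces. For $\alpha\in\mathbb C^n$, let $Z_\alpha$ be the union of the irreducible components of $V_I$ passing through $\alpha$; the exponent simplicial complex is $\mathrm{E}\Delta_\alpha=\{F\subseteq\{1,\ldots,n\}\mid \mathbb C^F\subseteq -\alpha+Z_\alpha\}$ (the void complex, with no faces at all, if $\alpha\notin V_I$). For $F\subseteq\{1,\ldots,n\}$, $S_F=S[x_i^{-1}\mid i\in F]$, with its natural $\mathbb Z^n$-grading. The Čech simplicial complex of $I$ in degree $\mathbf a\in\mathbb Z^n$ is $$\check{C}\Delta_{\mathbf a}=\{F\smallsetminus\mathrm{supp}(\mathbf a_-)\mid F\subseteq\{1,\ldots,n\},\ (S_F/IS_F)_{\mathbf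 a}=\Bbbk\},$$ where $(S_F/IS_F)_{\mathbf a}=\Bbbk$ means that this degree-$\mathbf a$ piece is nonzero (which forces $F\supseteq\mathrm{supp}(\mathbf a_-)$). For a simplicial complex $\Delta$ and a set $G$, $\mathrm{link}(G,\Delta)=\{F\in\Delta\mid F\cup G\in\Delta,\ F\cap G=\varnothing\}$. A complex $\Delta$ is a cone with apex $G$ if $F\cup G\in\Delta$ for every $F\in\Delta$ (equivalently, every facet contains $G$); the void complex satisfies this vacuously. *)

(* Defs.v *)
From mathcomp Require Import all_boot all_order all_algebra.
From mathcomp Require Import boolp classical_sets reals complex mpoly.

Set Implicit Arguments.
Unset Strict Implicit.
Unset Printing Implicit Defensive.

Import Order.TTheory GRing.Theory Num.Theory.
Local Open Scope classical_set_scope.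
Local Open Scope ring_scope.
Local Open Scope complex_scope.

Local Notation "x %:F" := (tofrac x).

Definition supp (n : nat) (T : nmodType) (v : 'I_n -> T) : {set 'I_n} :=
  [set i | v i != 0]%SET.

Definition neg_part (n : nat) (a : {ffun 'I_n -> int}) : {ffun 'I_n -> int} :=
  [ffun i => Num.max (- a i) 0].

(* Finite sums of products s * g with s in A and g in G.  For a subring A of K
   this is the A-submodule of K generated by G, that is, the ideal of A
   generated by G when G is a subset of A. *)
Definition span_over (K : comNzRingType) (A G : set K) : set K :=
  [set z | exists s : seq (K * K),
     (forall x, x \in s -> A x.1 /\ G x.2) /\ z = \sum_(x <- s) x.1 * x.2].

Definition monomial_ideal (k : fieldType) (n : nat) (I : set {mpoly k[n]}) :=
  exists M : set 'X_{1..n},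
    I = span_over setT [set ('X_[m] : {mpoly k[n]}) | m in M].

(* S_F and its ideals live inside the fraction field of S = k[x_1..x_n]. *)
Definition localization (k : fieldType) (n : nat) (F : {set 'I_n}) :
    set {fraction {mpoly k[n]}} :=
  [set z | exists (p : {mpoly k[n]}) (u : 'X_{1..n}),
     supp u \subset F /\ z = p%:F / ('X_[u] : {mpoly k[n]})%:F].

Definition localization_deg (k : fieldType) (n : nat) (F : {set 'I_n})
    (a : {ffun 'I_n -> int}) : set {fraction {mpoly k[n]}} :=
  [set z | exists (c : k) (m u : 'X_{1..n}),
     [/\ supp u \subset F, forall i, (m i)%:Z - (u i)%:Z = a i
       & z = (c *: 'X_[m])%:F / ('X_[u] : {mpoly k[n]})%:F]].

Definition localized_ideal (k : fieldType) (n : nat) (I : set {mpoly k[n]})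
    (F : {set 'I_n}) : set {fraction {mpoly k[n]}} :=
  span_over (@localization k n F) [set p%:F | p in I].

(* (S_F / I S_F)_a is the image of (S_F)_a in S_F / I S_F: it is nonzero iff
   some element of (S_F)_a is not in I S_F. *)
Definition quotient_deg_neq0 (k : fieldType) (n : nat) (I : set {mpoly k[n]})
    (F : {set 'I_n}) (a : {ffun 'I_n -> int}) : Prop :=
  exists2 z, @localization_deg k n F a z & ~ localized_ideal I F z.

Definition cech_complex (k : fieldType) (n : nat) (I : set {mpoly k[n]})
    (a : {ffun 'I_n -> int}) : set {set 'I_n} :=
  [set (F :\: supp (neg_part a))%SET | F in [set F | quotient_deg_neq0 I F a]].

Section Zariski.
Variables (R : realType) (n : nat).
Local Notation Cn := {ffun 'I_n -> R[i]}.

Definition zero_locus (P : set {mpoly R[i][n]}) : set Cn :=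
  [set v | forall p, P p -> p.@[v] = 0].

Definition zariski_closed (A : set Cn) : Prop :=
  exists P, A = zero_locus P.

Definition zariski_closure (A : set Cn) : set Cn := smallest zariski_closed A.

Definition zariski_irreducible (W : set Cn) : Prop :=
  W !=set0 /\
  forall A B, zariski_closed A -> zariski_closed B ->
    W `<=` A `|` B -> W `<=` A \/ W `<=` B.

Definition irreducible_component (V W : set Cn) : Prop :=
  [/\ zariski_irreducible W, W `<=` V &
      forall W', zariski_irreducible W' -> W' `<=` V -> W `<=` W' -> W' = W].

Definition coord_subspace (F : {set 'I_n}) : set Cn :=
  [set v | supp v \subset F].

Definition exponent_set (k : fieldType) (I : set {mpoly k[n]}) : set Cn :=
  [set [ffun i => (m i)%:R] | m in [set m : 'X_{1..n} | ~ I 'X_[m]]].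

Definition distracting_arrangement (k : fieldType) (I : set {mpoly k[n]}) :
    set Cn :=
  zariski_closure (exponent_set I).

Definition components_through (k : fieldType) (I : set {mpoly k[n]})
    (alpha : Cn) : set Cn :=
  [set z | exists W, [/\ irreducible_component (distracting_arrangement I) W,
                         W alpha & W z]].

Definition exponent_complex (k : fieldType) (I : set {mpoly k[n]})
    (alpha : Cn) : set {set 'I_n} :=
  [set F | coord_subspace F `<=`
           [set - alpha + z | z in components_through I alpha]].

Definition int_point (a : {ffun 'I_n -> int}) : Cn := [ffun i => (a i)%:~R].

(* xget returns the default -1 when alpha i is not a natural number. *)
Definition truncate_point (alpha : Cn) : {ffun 'I_n -> int} :=
  [ffun i => xget (-1) [set m%:Z | m in [set m : nat | alpha i = m%:R]]].

End Zariski.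

Definition cone_with_apex (n : nat) (G : {set 'I_n}) (D : set {set 'I_n}) :=
  forall F, D F -> D (F :|: G)%SET.

Definition link (n : nat) (G : {set 'I_n}) (D : set {set 'I_n}) :
    set {set 'I_n} :=
  [set F | [/\ D F, D (F :|: G)%SET & (F :&: G)%SET = finset.set0]].

(* Main.v *)
(** Write [N = supp a_-] and let [V] be the distracting arrangement.  Since
    [alpha + C^F] is irreducible, [F] is a face of the exponent complex iff
    [alpha + C^F] lies in [V].  We show that this happens iff every monomial
    [x^b] with [b = a] outside [F ∪ N] is standard; the same condition with
    [F ⊇ N] says that [(S_F / I S_F)_a] is nonzero, so both claims follow.
    If such an [x^b] lies in [I], then [∏_i ∏_(j < b_i) (X_i - j)] vanishes on
    all standard exponents, but not at the point of [alpha + C^F] whose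
    coordinates in [F] are those of [b].  Conversely, if all these [x^b] are
    standard, then a polynomial vanishing on their exponents vanishes on the
    whole affine space [alpha + C^(F ∪ N)], one coordinate at a time. *)

Require Import Defs.
From mathcomp Require Import all_boot all_order all_algebra.
From mathcomp Require Import boolp classical_sets reals complex mpoly.
Import Order.TTheory GRing.Theory Num.Theory.
Local Open Scope classical_set_scope.
Local Open Scope ring_scope.
Local Open Scope complex_scope.

Local Notation "x %:F" := (tofrac x).

(** * Polynomials vanishing on grids of natural numbers *)

Lemma exists_nat_nonroot (K : numFieldType) (q : {poly K}) :
  q != 0 -> exists m : nat, q.[m%:R] != 0.
Proof.
move=> q0; apply: contrapT => noroot.
(* In characteristic 0 these are [size q] distinct roots, one more than the degree of [q] allows. *)
pose rs := [seq (m%:R : K) | m <- iota 0 (size q)].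
have all_rs : all (root q) rs.
  apply/allP => _ /mapP[m _ ->]; apply: contrapT => /negP qm.
  by apply: noroot; exists m.
have uniq_rs : uniq rs.
  by rewrite map_inj_uniq ?iota_uniq// => x y /eqP; rewrite eqr_nat => /eqP.
by have := max_poly_roots q0 all_rs uniq_rs; rewrite size_map size_iota ltnn.
Qed.

Lemma meval_line (K : comNzRingType) (n : nat) (p : {mpoly K[n]})
    (v d : 'I_n -> K) :
  exists q : {poly K}, forall t, q.[t] = p.@[fun i => v i + t * d i].
Proof.
exists (\sum_(m <- msupp p) (p@_m)%:P *
          \prod_i ((v i)%:P + 'X * (d i)%:P) ^+ m i).
move=> t; rewrite mevalE horner_sum; apply: eq_bigr => m _.
rewrite hornerM hornerC horner_prod; congr (_ * _); apply: eq_bigr => i _.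
by rewrite horner_exp !hornerE.
Qed.

(** Coordinates are freed one at a time: the restriction of [p] to a line in direction [j] has every
    natural number as a root, hence is zero. *)
Lemma meval_eq0_grid (K : numFieldType) (n : nat) (p : {mpoly K[n]})
    (G : {set 'I_n}) (a : 'I_n -> K) :
  (forall b : 'I_n -> K, (forall i, i \notin G -> b i = a i) ->
     (forall i, i \in G -> exists m : nat, b i = m%:R) -> p.@[b] = 0) ->
  forall v : 'I_n -> K, (forall i, i \notin G -> v i = a i) -> p.@[v] = 0.
Proof.
move=> pgrid.
(* [s] lists the coordinates that need no longer be natural numbers. *)
suff H (s : seq 'I_n) (v : 'I_n -> K) : (forall i, i \notin G -> v i = a i) ->
    (forall i, i \in G -> i \notin s -> exists m : nat, v i = m%:R) ->
    p.@[v] = 0.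
  by move=> v va; apply: (H (enum G)) => // i iG; rewrite mem_enum iG.
elim: s v => [|j s IHs] v va vnat.
  by apply: pgrid => // i iG; apply: vnat.
have [jG|jG] := boolP (j \in G); last first.
  apply: IHs => // i iG si; apply: vnat => //; rewrite in_cons negb_or si andbT.
  by apply: contraNneq jG => <-.
have [q qE] := meval_line _ _ p (fun i => if i == j then 0 else v i)
                 (fun i => (i == j)%:R).
have qv : q.[v j] = p.@[v].
  rewrite qE; apply: meval_eq => i.
  by case: eqP => [->|_]; rewrite ?mulr1 ?add0r ?mulr0 ?addr0.
rewrite -qv; suff -> : q = 0 by rewrite horner0.
apply/eqP; apply: contrapT => /negP /exists_nat_nonroot[m] /negP; apply.
apply/eqP; rewrite qE; apply: IHs => i iG.
  have /negPf -> : i != j by apply: contraNneq iG => ->.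
  by rewrite mulr0 addr0 va.
case: (eqVneq i j) => [_ _|ij si]; first by exists m; rewrite mulr1 add0r.
rewrite mulr0 addr0; apply: vnat => //.
by rewrite in_cons negb_or ij.
Qed.

(** * Irreducible sets and components in the Zariski topology *)

Section ZariskiTopology.
Variables (R : realType) (n : nat).
Local Notation Cn := {ffun 'I_n -> R[i]}.

Lemma zariski_closureP (A : set Cn) (v : Cn) :
  zariski_closure A v <->
  forall p : {mpoly R[i][n]}, (forall w, A w -> p.@[w] = 0) -> p.@[v] = 0.
Proof.
split=> [Av p pA|Av B [[P ->] AB] p Pp].
  have /(_ _) := Av (zero_locus [set p]); apply => //.
  by split; [exists [set p] | move=> w Aw _ ->; apply: pA].
by apply: Av => w /AB; apply.
Qed.

Lemma coord_subspaceP (F : {set 'I_n}) (v : Cn) :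
  coord_subspace F v <-> forall i, i \notin F -> v i = 0.
Proof.
split=> [vF i iF|v0].
  apply/eqP; apply: contraNT iF => vi.
  by apply: (fintype.subsetP vF); rewrite inE.
apply/fintype.subsetP => i; rewrite inE; apply: contraNT => /v0 ->.
by rewrite eqxx.
Qed.

(** If neither closed set contains the translate, join a point missed by one to a point missed by
    the other. The line stays in the translate, and a nonzero univariate product gives a point on it
    outside both. *)
Lemma zariski_irreducible_translate (alpha : Cn) (F : {set 'I_n}) :
  zariski_irreducible [set alpha + v | v in coord_subspace F].
Proof.
split=> [|_ _ [P ->] [Q ->] FPQ].
  exists (alpha + 0); exists 0 => //; apply/coord_subspaceP => i.
  by rewrite ffunE.
apply: contrapT => /not_orP[].
move=> /nonsubset[x [[v vF <-] Px]] /nonsubset[y [[w wF <-] Qy]].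
have [p [Pp px]] : exists p, P p /\ p.@[alpha + v] != 0.
  apply: contrapT => nP; apply: Px => p Pp; apply: contrapT => /eqP px.
  by apply: nP; exists p.
have [q [Qq qy]] : exists q, Q q /\ q.@[alpha + w] != 0.
  apply: contrapT => nQ; apply: Qy => q Qq; apply: contrapT => /eqP qy.
  by apply: nQ; exists q.
pose l t : Cn := alpha + [ffun i => v i + t * (w i - v i)].
have lE (r : {mpoly R[i][n]}) t :
    r.@[fun i => (alpha + v) i + t * (w i - v i)] = r.@[l t].
  by apply: meval_eq => i; rewrite !ffunE addrA.
have [p' p'E] := meval_line _ _ p (alpha + v) (fun i => w i - v i).
have [q' q'E] := meval_line _ _ q (alpha + v) (fun i => w i - v i).
have l0 : l 0 = alpha + v by apply/ffunP => i; rewrite !ffunE mul0r addr0.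
have l1 : l 1 = alpha + w.
  by apply/ffunP => i; rewrite !ffunE mul1r [v i + _]addrC subrK.
have p'0 : p' != 0.
  by apply: contraNneq px => p'0; rewrite -l0 -lE -p'E p'0 horner0.
have q'0 : q' != 0.
  by apply: contraNneq qy => q'0; rewrite -l1 -lE -q'E q'0 horner0.
have [m] := exists_nat_nonroot _ (p' * q') (mulf_neq0 p'0 q'0).
rewrite hornerM p'E q'E !lE mulf_eq0 negb_or => /andP[/eqP pm /eqP qm].
have [|H|H] := FPQ (l m%:R); last 2 first.
- by apply: pm; apply: H.
- by apply: qm; apply: H.
exists [ffun i => v i + m%:R * (w i - v i)] => //.
move/coord_subspaceP: vF => vF; move/coord_subspaceP: wF => wF.
by apply/coord_subspaceP => i iF; rewrite ffunE vF// wF// subr0 mulr0 addr0.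
Qed.

(** Zorn's lemma is applied to the sets [X] such that [W ∪ X] is irreducible and lies in [V];
    adjoining [W] takes care of the empty chain. *)
Lemma irreducible_component_exists (V W : set Cn) :
  zariski_irreducible W -> W `<=` V ->
  exists2 W', irreducible_component V W' & W `<=` W'.
Proof.
move=> irrW WV.
have [|A [[irrA AV] maxA]] := @Zorn_bigcup _
    (fun X : set Cn => zariski_irreducible (W `|` X) /\ W `|` X `<=` V).
  move=> C CP Ctot; split; last first.
    by move=> x [/WV//|[X /CP[_ XV] Xx]]; apply: XV; right.
  split=> [|A B cA cB WCAB].
    by have [[x Wx] _] := irrW; exists x; left.
  have CAB X : C X -> W `|` X `<=` A \/ W `|` X `<=` B.
    move=> CX; have [[_ +] _] := CP X CX; apply=> //.
    by move=> x [Wx|Xx]; apply: WCAB; [left | right; exists X].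
  have WAB : W `<=` A \/ W `<=` B.
    by case: irrW => _; apply=> // x Wx; apply: WCAB; left.
  (* Since [C] is a chain, [x] and [y] lie together in [W] or in [W ∪ X] for a single member [X],
     whose irreducibility is contradicted. *)
  apply: contrapT => /not_orP[/nonsubset[x [Wx Ax]] /nonsubset[y [Wy By]]].
  have sep X : X `<=` A \/ X `<=` B -> X x -> X y -> False.
    by move=> [XA /XA|XB _ /XB].
  case: Wx Wy => [Wx|[X CX Xx]] [Wy|[Y CY Yy]].
  - exact: (sep _ WAB).
  - by apply: (sep _ (CAB Y CY)); [left | right].
  - by apply: (sep _ (CAB X CX)); [right | left].
  - have [XY|YX] := Ctot X Y CX CY.
    + by apply: (sep _ (CAB Y CY)); right => //; apply: XY.
    + by apply: (sep _ (CAB X CX)); right => //; apply: YX.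
exists (W `|` A); last by move=> x; left.
split=> // W' irrW' W'V WAW'.
have WW' : W `|` W' = W'.
  by apply/seteqP; split=> [x [Wx|//]|x]; [apply: WAW'; left|right].
apply: contrapT => neq; apply: (maxA W'); last by rewrite WW'.
split=> [x Ax|W'A]; first by apply: WAW'; right.
by apply: neq; apply/seteqP; split=> // x /W'A; right.
Qed.

(** A component containing [alpha + C^F] passes through [alpha], because [C^F] contains 0. *)
Lemma exponent_complexP (k : fieldType) (I : set {mpoly k[n]}) (alpha : Cn)
    (F : {set 'I_n}) :
  exponent_complex I alpha F <->
  [set alpha + v | v in coord_subspace F] `<=` @distracting_arrangement R n k I.
Proof.
split=> [DF _ [v /DF[z [W [[_ WV _] _ Wz]] <-] <-]|FV v vF].
  by rewrite addrA subrr add0r; apply: WV.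
have [W compW FW] :=
  irreducible_component_exists _ _ (zariski_irreducible_translate alpha F) FV.
exists (alpha + v); last by rewrite addrA addNr add0r.
exists W; split=> //; apply: FW; last by exists v.
exists 0; last exact: addr0.
by apply/coord_subspaceP => i; rewrite ffunE.
Qed.

End ZariskiTopology.

(** * Monomial ideals and graded pieces of their localizations *)

Section MonomialIdeals.
Variables (k : fieldType) (n : nat) (I : set {mpoly k[n]}).
Hypothesis hI : monomial_ideal I.

Lemma monomial_idealD p q : I p -> I q -> I (p + q).
Proof.
case: hI => M -> [s [sM ->]] [t [tM ->]]; exists (s ++ t); split.
  by move=> x; rewrite mem_cat => /orP[/sM|/tM].
by rewrite big_cat.
Qed.

Lemma monomial_ideal0 : I 0.
Proof. by case: hI => M ->; exists [::]; split=> //; rewrite big_nil. Qed.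

Lemma monomial_idealMl p q : I q -> I (p * q).
Proof.
case: hI => M -> [s [sM ->]]; exists [seq (p * x.1, x.2) | x <- s]; split.
  by move=> _ /mapP[x /sM[_ ?] ->].
by rewrite big_map mulr_sumr; apply: eq_bigr => x _; rewrite mulrA.
Qed.

Lemma monomial_ideal_mnm_le (m m' : 'X_{1..n}) :
  (forall i, (m i <= m' i)%N) -> I 'X_[m] -> I 'X_[m'].
Proof.
move=> le_mm' Im; rewrite -(@submK _ m m'); last exact/mnm_lepP.
by rewrite mpolyXD; apply: monomial_idealMl.
Qed.

Lemma tofrac_mpolyX_neq0 (m : 'X_{1..n}) :
  ('X_[m] : {mpoly k[n]})%:F != 0.
Proof.
rewrite tofrac_eq0; apply/eqP => /(congr1 (mcoeff m)).
by rewrite mcoeffX eqxx mcoeff0 => /eqP; rewrite oner_eq0.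
Qed.

Lemma localized_ideal_clear_denominator (F : {set 'I_n}) z :
  localized_ideal I F z ->
  exists w : 'X_{1..n}, supp w \subset F /\
    exists2 g, I g & ('X_[w] : {mpoly k[n]})%:F * z = g%:F.
Proof.
case=> s [sP ->]; elim: s sP => [_|x s IHs sP].
  exists 0%MM; split; last first.
    by exists 0; [exact: monomial_ideal0 | rewrite big_nil mulr0 tofrac0].
  by apply/fintype.subsetP => i; rewrite inE mnm0E.
have [|w [wF [g Ig gE]]] := IHs.
  by move=> y ys; apply: sP; rewrite in_cons ys orbT.
have [[p [u [uF x1E]]] [h Ih x2E]] := sP x (mem_head _ _).
exists (u + w)%MM; split.
  apply/fintype.subsetP => i; rewrite inE mnmDE addn_eq0 negb_and.
  case/orP => ?; first by apply: (fintype.subsetP uF); rewrite inE.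
  by apply: (fintype.subsetP wF); rewrite inE.
exists ('X_[w] * p * h + 'X_[u] * g).
  by apply: monomial_idealD; apply: monomial_idealMl.
rewrite big_cons mpolyXD !(tofracD, tofracM) -gE x1E -x2E mulrDr.
congr (_ + _); last by rewrite mulrA.
rewrite [X in X * _]mulrC -!mulrA; congr (_ * _).
by rewrite mulrCA mulVKf// tofrac_mpolyX_neq0.
Qed.

Lemma supp_neg_part (a : {ffun 'I_n -> int}) i :
  (i \in supp (neg_part a)) = (a i < 0).
Proof.
rewrite inE ffunE maxEle oppr_le0.
by case: leP => // /lt_eqF ai; rewrite oppr_eq0 ai.
Qed.

(** The combinatorial condition through which the two complexes are compared. It is vacuous if [a]
    is negative somewhere outside [F], so both characterizations make [F] contain the negative
    support. *)
Definition standard_fiber (F : {set 'I_n}) (a : {ffun 'I_n -> int}) : Prop :=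
  forall b : 'X_{1..n}, (forall i, i \notin F -> (b i)%:Z = a i) -> ~ I 'X_[b].

(** For [F] containing the negative support, [(S_F)_a] is spanned by the Laurent monomial [x^a],
    which lies in [I S_F] iff some monomial of [I] has exponents agreeing with [a] off [F]. *)
Lemma quotient_deg_neq0P (F : {set 'I_n}) (a : {ffun 'I_n -> int}) :
  quotient_deg_neq0 I F a <->
  supp (neg_part a) \subset F /\ standard_fiber F a.
Proof.
split=> [[z [c [m [u [uF mua zE]]]] nIz]|[aF Fa]].
  have ma i : i \notin F -> a i = (m i)%:Z.
    move=> iF; rewrite -mua; suff /eqP -> : u i == 0%N by rewrite subr0.
    by apply: contraNT iF => ui; apply: (fintype.subsetP uF); rewrite inE.
  split=> [|b ba Ib].
    apply/fintype.subsetP => i; rewrite supp_neg_part.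
    by apply: contraTT => /ma ->; rewrite -leNgt.
  (* Multiplying by [x^w], a unit of [S_F], makes the numerator [x^m] divisible by [x^b]. *)
  apply: nIz; pose w := [multinom (if i \in F then b i else 0)%N | i < n].
  have bmw : (b <= m + w)%MM.
    apply/mnm_lepP => i; rewrite mnmDE mnmE.
    case: ifPn => [_|iF]; first exact: leq_addl.
    by have := ba i iF; rewrite ma// => -[->]; rewrite addn0.
  exists [:: ((c *: 'X_[(m + w - b)%MM])%:F /
                ('X_[(u + w)%MM] : {mpoly k[n]})%:F,
              ('X_[b] : {mpoly k[n]})%:F)].
  split=> [x|].
    rewrite inE => /eqP -> /=; split; last by exists 'X_[b].
    exists (c *: 'X_[(m + w - b)%MM]), (u + w)%MM; split=> //.
    apply/fintype.subsetP => i; rewrite inE mnmDE mnmE addn_eq0 negb_and.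
    case/orP => [ui|]; first by apply: (fintype.subsetP uF); rewrite inE.
    by case: ifP.
  rewrite big_seq1 /= zE mulrAC -tofracM -scalerAl -mpolyXD submK//.
  rewrite !mpolyXD scalerAl !tofracM -mulf_div divff ?mulr1//.
  exact: tofrac_mpolyX_neq0.
pose m := [multinom (if (a i < 0)%R then 0 else `|a i|)%N | i < n].
pose u := [multinom (if (a i < 0)%R then `|a i| else 0)%N | i < n].
have uF : supp u \subset F.
  apply: fintype.subset_trans aF; apply/fintype.subsetP => i.
  by rewrite supp_neg_part inE mnmE; case: ifP.
exists ((1 *: 'X_[m])%:F / ('X_[u] : {mpoly k[n]})%:F).
  exists 1, m, u; split=> // i; rewrite !mnmE.
  case: ltP => ai; first by rewrite ltz0_abs// sub0r opprK.
  by rewrite gez0_abs// subr0.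
rewrite scale1r => /localized_ideal_clear_denominator[w [wF [g Ig gE]]].
apply: (Fa (m + w)%MM) => [i iF|].
  have /negPf ai : ~~ (a i < 0).
    apply: contraNN iF => ai.
    by apply: (fintype.subsetP aF); rewrite supp_neg_part.
  rewrite mnmDE mnmE ai; suff /eqP -> : w i == 0%N.
    by rewrite addn0 gez0_abs// leNgt ai.
  by apply: contraNT iF => wi; apply: (fintype.subsetP wF); rewrite inE.
suff -> : 'X_[(m + w)%MM] = 'X_[u] * g :> {mpoly k[n]}.
  exact: monomial_idealMl.
apply/eqP; rewrite -tofrac_eq tofracM -gE mulrCA [X in _ * X]mulrC divfK.
  by rewrite addmC mpolyXD tofracM.
exact: tofrac_mpolyX_neq0.
Qed.

End MonomialIdeals.

(** * Faces of the exponent complex, its apex and the link *)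

Section ExponentComplex.
Variables (R : realType) (k : fieldType) (n : nat) (I : set {mpoly k[n]}).
Hypothesis hI : monomial_ideal I.
Local Notation Cn := {ffun 'I_n -> R[i]}.
Variables (a : {ffun 'I_n -> int}) (alpha : Cn).
Hypothesis alpha_nat : forall i, 0 <= a i -> alpha i = (a i)%:~R.
Hypothesis alpha_notnat : forall i, a i < 0 -> forall m : nat, alpha i <> m%:R.

Lemma exponent_complexE (F : {set 'I_n}) :
  exponent_complex I alpha F <->
  standard_fiber k n I (F :|: supp (neg_part a)) a.
Proof.
split=> [/exponent_complexP FV b ba Ib|Fa]; last first.
  apply/exponent_complexP => _ [v vF <-]; apply/zariski_closureP => p pI.
  apply: (meval_eq0_grid _ _ p (F :|: supp (neg_part a)) alpha)
    => [w wa wnat|i].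
    (* The grid point [w] is itself the exponent of a standard monomial; the default 0 is never
       taken, by [wnat]. *)
    pose b := [multinom (if i \in F :|: supp (neg_part a)
                 then xget 0%N [set m | w i = m%:R] else `|a i|%N) | i < n].
    rewrite (@meval_eq _ _ _ [ffun i => (b i)%:R]).
      apply: pI; exists b => //; apply: Fa => i iF.
      rewrite mnmE (negPf iF) gez0_abs// leNgt; apply: contraNN iF => ai.
      by rewrite inE supp_neg_part ai orbT.
    move=> i; rewrite ffunE mnmE; case: ifPn => [iF|iF].
      by case: xgetP => [m _ ->//|none]; have [m /none] := wnat i iF.
    have ai : 0 <= a i.
      rewrite leNgt; apply: contraNN iF => ai.
      by rewrite inE supp_neg_part ai orbT.
    by rewrite wa// alpha_nat// -[in LHS](gez0_abs ai).
  rewrite inE negb_or => /andP[iF _]; rewrite ffunE.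
  by move/coord_subspaceP: vF => ->//; rewrite addr0.
pose q : {mpoly R[i][n]} := \prod_i \prod_(j < b i) ('X_i - (j%:R)%:MP).
have qE v : q.@[v] = \prod_i \prod_(j < b i) (v i - j%:R).
  rewrite rmorph_prod; apply: eq_bigr => i _.
  rewrite rmorph_prod; apply: eq_bigr => j _.
  by rewrite /= mevalB mevalXU mevalC.
(* [alpha + v] agrees with [b] on [F] and with [alpha] elsewhere. *)
pose v : Cn := [ffun i => if i \in F then (b i)%:R - alpha i else 0].
have q0 (w : Cn) : exponent_set I w -> q.@[w] = 0.
  case=> m nIm <-; rewrite qE.
  have [i mb] : exists i, (m i < b i)%N.
    apply: contrapT => nmb; apply: nIm.
    apply: (monomial_ideal_mnm_le _ _ _ hI b) => // i.
    by rewrite leqNgt; apply/negP => mb; apply: nmb; exists i.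
  by rewrite (bigD1 i)//= (bigD1 (Ordinal mb))//= ffunE subrr !mul0r.
have /zariski_closureP/(_ q q0)/eqP : distracting_arrangement I (alpha + v).
  apply: FV; exists v => //; apply/coord_subspaceP => i /negPf iF.
  by rewrite ffunE iF.
rewrite qE => /prodf_eq0[i _ /prodf_eq0[j _]].
(* No factor vanishes: the coordinate is either [b i], which exceeds [j], or, off [F] with
   [a i < 0], not a natural number. *)
rewrite !ffunE; case: ifPn => iF.
  by rewrite [alpha i + _]addrC subrK subr_eq0 eqr_nat gtn_eqF.
rewrite addr0 subr_eq0 => /eqP; have [ai|ai] := leP 0 (a i); last first.
  exact: alpha_notnat.
rewrite alpha_nat// -ba; last by rewrite inE negb_or iF supp_neg_part -leNgt.
by move=> /eqP; rewrite eqr_nat gtn_eqF.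
Qed.

Lemma exponent_complex_cone :
  cone_with_apex (supp (neg_part a)) (exponent_complex I alpha).
Proof.
move=> F /exponent_complexE ?; apply/exponent_complexE.
by rewrite -finset.setUA finset.setUid.
Qed.

(** Removing and adjoining the apex are inverse bijections between the sets containing it and those
    disjoint from it, and both sides test [standard_fiber] on the larger set. *)
Lemma cech_complex_link :
  cech_complex I a = link (supp (neg_part a)) (exponent_complex I alpha).
Proof.
apply/seteqP; split=> [_ [F /quotient_deg_neq0P[//|aF Fa] <-]|F [DF _ Fa]].
  have DF : exponent_complex I alpha (F :\: supp (neg_part a))%SET.
    apply/exponent_complexE; rewrite finset.setUC finset.setDE finset.setUIr.
    by rewrite finset.setUCr finset.setIT (finset.setUidPr aF).
  split=> //; first exact: exponent_complex_cone.
  rewrite finset.setDE -finset.setIA [(~: _ :&: _)%SET]finset.setIC.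
  by rewrite finset.setICr finset.setI0.
exists (F :|: supp (neg_part a))%SET.
  apply/quotient_deg_neq0P => //; split; first exact: finset.subsetUr.
  exact/exponent_complexE.
rewrite finset.setDUl finset.setDv finset.setU0; apply/finset.setDidPl.
by rewrite -finset.setI_eq0 Fa.
Qed.

End ExponentComplex.

Theorem theorem4p1 (R : realType) (k : fieldType) (n : nat)
    (I : set {mpoly k[n]}) (hI : monomial_ideal I) :
  (forall a : {ffun 'I_n -> int},
     cone_with_apex (supp (neg_part a)) (exponent_complex I (int_point R a)) /\
     cech_complex I a =
       link (supp (neg_part a)) (exponent_complex I (int_point R a))) /\
  (forall alpha : {ffun 'I_n -> R[i]},
     let alpha' := truncate_point alpha in
     cone_with_apex (supp (neg_part alpha')) (exponent_complex I alpha) /\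
     cech_complex I alpha' =
       link (supp (neg_part alpha')) (exponent_complex I alpha)).
Proof.
split=> [a|alpha alpha'].
  have a_nat i : 0 <= a i -> int_point R a i = (a i)%:~R by rewrite ffunE.
  have a_notnat i : a i < 0 -> forall m : nat, int_point R a i <> m%:R.
    move=> ai m; rewrite ffunE => /eqP; rewrite -[m%:R]/((m%:Z)%:~R) eqr_int.
    by move=> /eqP am; rewrite am in ai.
  by split; [exact: exponent_complex_cone | exact: cech_complex_link].
(* The default -1 is the only negative value of [alpha'], so its sign detects whether a coordinate
   is natural. *)
have alphaE i : (0 <= alpha' i -> alpha i = (alpha' i)%:~R) /\
    (alpha' i < 0 -> forall m : nat, alpha i <> m%:R).
  rewrite ffunE; case: xgetP => [_ _ [m am <-]|none]; split=> //.
  by move=> _ m am; apply: (none m%:Z); exists m.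
have alpha_nat i := (alphaE i).1; have alpha_notnat i := (alphaE i).2.
by split; [exact: exponent_complex_cone | exact: cech_complex_link].
Qed.
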